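(* Let $(\Omega,\mu)$ be a finite probability space and $f\colon\Omega^n\to\mathbb{R}$. Let $\gamma_2>\gamma_1>0$, $r>1$, and let $d$ be a nonnegative integer with $d\le\frac12\log(\gamma_2/\gamma_1)$. Suppose that for all $S\subseteq[n]$ with $|S|\le d$ and all $x\in\Omega^S$ we have $\|f_{S\to x}\|_1\le r^{|S|}\gamma_1$ and $\|f_{S\to x}\|_2\le r^{|S|}\gamma_2$. Then \[\|f^{=d}\|_2^2\le\gamma_1^2\left(\frac{2200\,r^2\log(\gamma_2/\gamma_1)}{d}\right)^d.\]
   Context: Norms are with respect to the product measure $\mu^n$ (restrictions are normed over the remaining coordinates); $\log$ is natural; convention $(\cdot)^0=1$. $f_{S\to x}(y)=f(x,y)$. For $i\in[n]$, $E_i$ averages over coordinate $i$ according to $\mu$, $L_i=I-E_i$, $E_S=\prod_{i\in S}E_i$, $L_S=\prod_{i\in S}L_i$; $f^{=T}=E_{[n]\setminus T}L_Tf$ and $f^{=d}=\sum_{|T|=d}f^{=T}$. *)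

(* Defs.v *)
From mathcomp Require Import all_boot all_order all_algebra.
From mathcomp Require Import reals exp.
Set Implicit Arguments. Unset Strict Implicit. Unset Printing Implicit Defensive.
Import Order.TTheory GRing.Theory Num.Theory.
Local Open Scope ring_scope.

Section Defs.
Variables (R : realType) (Omega : finType) (mu : Omega -> R) (n : nat).

Definition pt := {ffun 'I_n -> Omega}.

Definition pweight (x : pt) : R := \prod_(i < n) mu (x i).

Definition Expn (g : pt -> R) : R := \sum_(x : pt) pweight x * g x.

Definition L1norm (g : pt -> R) : R := Expn (fun x => `|g x|).
Definition L2norm (g : pt -> R) : R := Num.sqrt (Expn (fun x => g x ^+ 2)).

Definition upd (x : pt) (i : 'I_n) (a : Omega) : pt :=
  [ffun j => if j == i then a else x j].

Definition Eop (i : 'I_n) (g : pt -> R) : pt -> R :=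
  fun x => \sum_(a : Omega) mu a * g (upd x i a).
Definition Lop (i : 'I_n) (g : pt -> R) : pt -> R := fun x => g x - Eop i g x.

Definition ES (S : {set 'I_n}) (g : pt -> R) : pt -> R :=
  foldr Eop g (enum S).
Definition LS (S : {set 'I_n}) (g : pt -> R) : pt -> R :=
  foldr Lop g (enum S).

Definition fEqT (f : pt -> R) (T : {set 'I_n}) : pt -> R :=
  ES (~: T) (LS T f).
Definition fEqd (f : pt -> R) (d : nat) : pt -> R :=
  fun x => \sum_(T : {set 'I_n} | #|T| == d) fEqT f T x.

(* restriction f_{S -> x}: coordinates in S fixed to those of x; as a
   function of the remaining coordinates (coordinates of y in S ignored) *)
Definition restr (f : pt -> R) (S : {set 'I_n}) (x : pt) : pt -> R :=
  fun y => f [ffun j => if j \in S then x j else y j].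

End Defs.

(* Main.v *)
Require Import Defs.
From mathcomp Require Import all_boot all_order all_algebra.
From mathcomp Require Import boolp reals sequences exp.
From mathcomp Require Import ring lra.
Import Order.TTheory GRing.Theory Num.Theory.
Local Open Scope ring_scope.

(** Let [g = f^{=d}], [N = ||g||_2^2], let [m] be an integer close to
[log(gamma2 / gamma1) / d], and let [H] be the sum of the squares
[(f^{=T})^2] over [|T| = d].  Replacing one coordinate at a time, a pointwise
inequality in the spirit of [e^u <= u + e^(u^2)] gives
[E g^(2m) <= (4m)^(dm) E H^m], a square-function form of hypercontractivity.

Hoelder's inequality with exponents interpolating [||f||_1] and [||f||_2] turns
a bound [E H^m <= w^m] into [N^2 <= gamma1^2 L (4m)^d w], where
[L = (gamma2 / gamma1)^(2/m)].

Conversely, write [E H^m] as the sum over [T] of [E (f^{=T})^2 H^(m-1)] and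
condition on [x_T].  There [H] is at most the sum over [A] included in [T] of
the level [d - |A|] functions of the derivatives of [f] along [A].  These
derivatives are again global, with both gammas multiplied by [(2r)^|A|], so
induction on [d] bounds the terms with [A] nonempty, and induction on the
exponent the term with [A] empty.  This gives [E H^m <= w^m] with [w] the larger of [2^d N] and
[gamma1^2 L (16 m r^2)^d]; together with the previous bound on [N^2] it forces
[N <= gamma1^2 L (16 m r^2)^d].  Since [2 <= log(gamma2 / gamma1) / d], taking
the integer part costs little and [L <= e^(3d)]. *)

(** * Elementary inequalities for powers and weighted sums *)

Section PowerInequalities.
Variable R : realType.
Implicit Types (x y z A B s : R) (m k : nat).

Lemma le_of_eq x y : x = y -> x <= y. Proof. by move=> ->. Qed.

(** Right side minus left side is half the double sum of [p i * p j * ((G i ^+ k - G j ^+ k) * (G i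
    - G j))], whose two differences have the same sign. *)
Lemma chebyshev_pow (I : finType) (P : pred I) (p G : I -> R) k :
  (forall i, 0 <= p i) -> (forall i, 0 <= G i) ->
  (\sum_(i | P i) p i * G i ^+ k) * (\sum_(i | P i) p i * G i) <=
  (\sum_(i | P i) p i) * (\sum_(i | P i) p i * G i ^+ k.+1).
Proof.
move=> p0 G0.
have dist (u v : I -> R) : (\sum_(i | P i) u i) * (\sum_(i | P i) v i) =
    \sum_(i | P i) \sum_(j | P j) u i * v j.
  by rewrite big_distrl; apply: eq_bigr => i _; rewrite big_distrr.
suff : 0 <= \sum_(i | P i) \sum_(j | P j)
    p i * p j * ((G i ^+ k - G j ^+ k) * (G i - G j)).
  have E i j : p i * p j * ((G i ^+ k - G j ^+ k) * (G i - G j)) =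
      p i * (p j * G j ^+ k.+1) + p i * G i ^+ k.+1 * p j
      - p i * G i ^+ k * (p j * G j) - p i * G i * (p j * G j ^+ k).
    by rewrite !exprS; ring.
  under eq_bigr => i _ do under eq_bigr => j _ do rewrite E.
  under eq_bigr => i _ do rewrite !sumrB big_split /=.
  rewrite !sumrB big_split /= -!dist; lra.
apply: sumr_ge0 => i _; apply: sumr_ge0 => j _.
apply: mulr_ge0; first by rewrite mulr_ge0.
have [le|/ltW le] := leP (G i) (G j).
  by apply: mulr_le0; rewrite subr_le0 // lerXn2r ?nnegrE.
by apply: mulr_ge0; rewrite subr_ge0 // lerXn2r ?nnegrE.
Qed.

(** Jensen's inequality for unnormalised weights, gained one exponent at a time from Chebyshev's sum
    inequality. *)
Lemma power_mean (I : finType) (P : pred I) (p G : I -> R) k :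
  (forall i, 0 <= p i) -> (forall i, 0 <= G i) ->
  (\sum_(i | P i) p i * G i) ^+ k.+1 <=
  (\sum_(i | P i) p i) ^+ k * \sum_(i | P i) p i * G i ^+ k.+1.
Proof.
move=> p0 G0; elim: k => [|k IH].
  by rewrite expr0 mul1r expr1; under [leRHS]eq_bigr => i _ do rewrite expr1.
have Ge0 l : 0 <= \sum_(i | P i) p i * G i ^+ l.
  by apply: sumr_ge0 => i _; rewrite mulr_ge0 ?exprn_ge0.
have G10 : 0 <= \sum_(i | P i) p i * G i.
  by apply: sumr_ge0 => i _; rewrite mulr_ge0.
rewrite exprSr (le_trans (ler_wpM2r G10 IH)) // -mulrA exprSr -mulrA.
rewrite ler_wpM2l ?exprn_ge0 ?sumr_ge0 //.
exact: chebyshev_pow.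
Qed.

Lemma cauchy_schwarz_sum (I : finType) (P : pred I) (p u v : I -> R) :
  (forall i, 0 <= p i) ->
  (\sum_(i | P i) p i * u i * v i) ^+ 2 <=
  (\sum_(i | P i) p i * u i ^+ 2) * (\sum_(i | P i) p i * v i ^+ 2).
Proof.
move=> p0.
have dist (a b : I -> R) : (\sum_(i | P i) a i) * (\sum_(i | P i) b i) =
    \sum_(i | P i) \sum_(j | P j) a i * b j.
  by rewrite big_distrl; apply: eq_bigr => i _; rewrite big_distrr.
(* Lagrange's identity: this double sum is twice the gap. *)
suff : 0 <= \sum_(i | P i) \sum_(j | P j)
    p i * p j * (u i * v j - u j * v i) ^+ 2.
  have E i j : p i * p j * (u i * v j - u j * v i) ^+ 2 =
      p i * u i ^+ 2 * (p j * v j ^+ 2) + p i * v i ^+ 2 * (p j * u j ^+ 2)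
      - p i * u i * v i * (p j * u j * v j)
      - p i * u i * v i * (p j * u j * v j) by ring.
  under eq_bigr => i _ do under eq_bigr => j _ do rewrite E.
  under eq_bigr => i _ do rewrite !sumrB big_split /=.
  rewrite !sumrB big_split /= -!dist; lra.
apply: sumr_ge0 => i _; apply: sumr_ge0 => j _.
by rewrite mulr_ge0 ?sqr_ge0 ?mulr_ge0.
Qed.

(** The remainder is a polynomial in [z] with nonnegative coefficients, so its modulus at [z] is at
    most its value at [y]; the recursion [E] shows this without expanding. *)
Lemma bernoulli_remainder_le m z y : `|z| <= y ->
  `|(1 + z) ^+ m - 1 - m%:R * z| <= (1 + y) ^+ m - 1 - m%:R * y.
Proof.
move=> zy; elim: m => [|m IH].
  by rewrite !expr0 !mul0r !subr0 subrr normr0.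
have E (t : R) : (1 + t) ^+ m.+1 - 1 - m.+1%:R * t =
  (1 + t) * ((1 + t) ^+ m - 1 - m%:R * t) + m%:R * t ^+ 2.
  by rewrite exprS -natr1; ring.
rewrite !E (le_trans (ler_normD _ _)) // lerD //.
  rewrite normrM ler_pM // (le_trans (ler_normD _ _)) // normr1 lerD2l //.
rewrite normrM normr_nat normrX ler_wpM2l // lerXn2r ?nnegrE //.
exact: le_trans zy.
Qed.

Lemma expr1D_le_quadratic k y : 0 <= y -> k%:R * y <= 1 + y ->
  (1 + y) ^+ k <= 1 + k%:R * y + k%:R ^+ 2 * y ^+ 2.
Proof.
move=> y0; elim: k => [|k IH] ky.
  by rewrite expr0 mul0r expr0n mul0r !addr0.
rewrite exprSr; move: ky; rewrite -natr1 => ky.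
have k0 : 0 <= k%:R :> R by [].
have IH1 := IH ltac:(nra).
(* The hypothesis at [k + 1] says [k y <= 1], which absorbs the cubic term into the slack
   [(k + 1)^2 - k^2 - k = k + 1] of the quadratic one. *)
have : k%:R ^+ 2 * y ^+ 3 <= (k%:R + 1) * y ^+ 2.
  rewrite exprS mulrA ler_wpM2r ?sqr_ge0 //.
  have : k%:R * (k%:R * y) <= k%:R * 1 by rewrite ler_wpM2l //; lra.
  lra.
have : (1 + y) ^+ k * (1 + y) <=
   (1 + k%:R * y + k%:R ^+ 2 * y ^+ 2) * (1 + y) by rewrite ler_wpM2r //; lra.
lra.
Qed.

Lemma expr1D_inv4_le2 m k : (0 < m)%N -> (k <= m)%N ->
  (1 + (4 * m%:R)^-1 : R) ^+ k <= 2.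
Proof.
move=> m0 km.
have m1 : 1 <= m%:R :> R by rewrite ler1n.
have kmR : k%:R <= m%:R :> R by rewrite ler_nat.
set u := (4 * m%:R)^-1; have mu4 : m%:R * u * 4 = 1.
  by rewrite /u -mulrA mulrC -mulrA mulVf // lt0r_neq0 //; lra.
have u0 : 0 <= u by rewrite invr_ge0; lra.
have ku : k%:R * u <= m%:R * u by rewrite ler_wpM2r.
have ku0 : 0 <= k%:R * u by rewrite mulr_ge0.
have ku1 : k%:R * u <= 1 + u by lra.
apply: le_trans (@expr1D_le_quadratic k u u0 ku1) _.
have : (k%:R * u) * (k%:R * u) <= 1 * (k%:R * u) by rewrite ler_wpM2r //; lra.
lra.
Qed.

Lemma two_point_scalar m y : (0 < m)%N -> 0 <= y ->
  (1 + y) ^+ (2 * m) - 2 * m%:R * y <= (1 + 4 * m%:R * y ^+ 2) ^+ m.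
Proof.
move=> m0 y0.
have m1 : 1 <= m%:R :> R by rewrite ler1n.
have my0 : 0 <= m%:R * y by rewrite mulr_ge0.
(* Above this threshold already [(1 + y)^2 <= 1 + 4 m y^2]. Below it, the second-order bound on the
   left meets Bernoulli's inequality on the right, both at [1 + 4 m^2 y^2]. *)
have [small|big] := leP ((4 * m%:R - 1) * y) 2.
  have := @expr1D_le_quadratic (2 * m) y y0.
  rewrite natrM => H0; have {H0} H := H0 ltac:(lra).
  have H2 : 1 + m%:R * (4 * m%:R * y ^+ 2) <= (1 + 4 * m%:R * y ^+ 2) ^+ m.
    have b0 : 0 <= 4 * m%:R * y ^+ 2 by rewrite mulr_ge0 ?sqr_ge0 // mulr_ge0.
    move: (4 * _ * _) b0 => b b0.
    elim: (m) => [|k IH]; first by rewrite expr0 mul0r addr0.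
    rewrite exprS -natr1.
    have : (1 + b) * (1 + k%:R * b) <= (1 + b) * (1 + b) ^+ k.
      by rewrite ler_wpM2l //; lra.
    have : 0 <= k%:R * b * b by rewrite !mulr_ge0.
    lra.
  lra.
rewrite exprM (@le_trans _ _ (((1 + y) ^+ 2) ^+ m)) //; first by lra.
rewrite lerXn2r ?nnegrE ?sqr_ge0 //.
  by rewrite addr_ge0 // mulr_ge0 ?sqr_ge0 // mulr_ge0.
have : 2 * y <= (4 * m%:R - 1) * y * y by rewrite ler_wpM2r // ltW.
lra.
Qed.

(* The linear term [2 m A^(m-1) s] averages to zero over the coordinate in
   play; dropping it leaves the cross term out of the right-hand side. *)
Lemma two_point_vector m A B s : (0 < m)%N -> 0 <= A -> 0 <= B ->
  s ^+ 2 <= A * B ->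
  (A + 2 * s + B) ^+ m <=
    (A + 4 * m%:R * B) ^+ m + 2 * m%:R * (A ^+ m.-1 * s).
Proof.
move=> m0 A0 B0 sAB.
have m1 : 1 <= m%:R :> R by rewrite ler1n.
have [A00|A1] := eqVneq A 0.
  move: sAB; rewrite A00 mul0r => s0.
  have {s0} -> : s = 0 by apply/eqP; rewrite -sqrf_eq0 eq_le s0 sqr_ge0.
  rewrite !mulr0 !add0r addr0 lerXn2r ?nnegrE //; first by rewrite !mulr_ge0.
  by rewrite ler_peMl //; lra.
have {A1}Ap : 0 < A by rewrite lt0r A1.
(* Dividing by [A] normalises the problem; Cauchy-Schwarz becomes [|t| <= y] with [y = sqrt b]. *)
pose b := B / A; pose t := s / A.
have b0 : 0 <= b by rewrite divr_ge0.
have Bb : B = A * b by rewrite /b mulrC divfK ?gt_eqF.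
have st : s = A * t by rewrite /t mulrC divfK ?gt_eqF.
have tb : t ^+ 2 <= b.
  move: sAB; rewrite st Bb exprMn mulrA -expr2 ler_pM2l // exprn_gt0 //.
pose y := Num.sqrt b.
have y0 : 0 <= y by apply: sqrtr_ge0.
have yb : y ^+ 2 = b by rewrite sqr_sqrtr.
have ty : `|t| <= y by rewrite -sqrtr_sqr ler_wsqrtr.
have tyb : `|2 * t + b| <= 2 * y + b.
  by move: ty; rewrite !ler_norml => /andP[? ?]; apply/andP; split; lra.
(* Only the linear term keeps the sign of [t]; in the remainder [t] may be replaced by [y], where
   [1 + 2 y + b] is the square of [1 + y]. *)
have H1 := @bernoulli_remainder_le m _ _ tyb.
have H2 := le_trans (ler_norm _) H1.
have E1 : (1 + (2 * y + b)) ^+ m = (1 + y) ^+ (2 * m).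
  by rewrite exprM; congr (_ ^+ _); rewrite -yb; ring.
have H3 := @two_point_scalar m y m0 y0.
rewrite E1 in H2; rewrite yb in H3.
have -> : A + 2 * s + B = A * (1 + (2 * t + b)) by rewrite st Bb; ring.
have -> : A + 4 * m%:R * B = A * (1 + 4 * m%:R * b) by rewrite Bb; ring.
have -> : 2 * m%:R * (A ^+ m.-1 * s) = A ^+ m * (2 * m%:R * t).
  have -> : A ^+ m = A ^+ m.-1 * A by rewrite -exprSr prednK.
  by rewrite st; ring.
rewrite !exprMn -mulrDr ler_wpM2l ?exprn_ge0 //; lra.
Qed.

End PowerInequalities.

(** * Expectation on the product space and the one-coordinate operators *)

Section ProductSpace.
Variables (R : realType) (Omega : finType) (mu : Omega -> R) (n : nat).
Hypothesis mu_ge0 : forall a, 0 <= mu a.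
Hypothesis mu_sum1 : \sum_(a : Omega) mu a = 1.

Local Notation pt := (pt Omega n).
Local Notation fn := (pt -> R).
Local Notation E := (@Expn R Omega mu n).
Local Notation P := (@fEqT R Omega mu n).
Implicit Types (f g h : fn) (x y z : pt) (S T A B : {set 'I_n}) (i j : 'I_n).

Definition mix S x y : pt := [ffun j => if j \in S then x j else y j].

Lemma mix_set0 x y : mix set0 x y = y.
Proof. by apply/ffunP => j; rewrite ffunE inE. Qed.

Lemma mix_upd S x y i a : i \notin S ->
  upd (mix S x y) i a = mix S x (upd y i a).
Proof.
move=> iS; apply/ffunP => j; rewrite !ffunE; case: eqP => // ->.
by rewrite (negbTE iS).
Qed.

Lemma mix_setU1 S x y i : mix (i |: S) x y = upd (mix S x y) i (x i).
Proof.
by apply/ffunP => j; rewrite !ffunE !inE; case: eqP => // ->.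
Qed.

Lemma upd_upd x i a b : upd (upd x i a) i b = upd x i b.
Proof. by apply/ffunP => j; rewrite !ffunE; case: eqP. Qed.

Lemma upd_id x i : upd x i (x i) = x.
Proof. by apply/ffunP => j; rewrite !ffunE; case: eqP => // ->. Qed.

Lemma updC x i j a b : i != j -> upd (upd x i a) j b = upd (upd x j b) i a.
Proof.
move=> ij; apply/ffunP => k; rewrite !ffunE.
by case: eqP => // ->; case: eqP => // e; rewrite -e eqxx in ij.
Qed.

Lemma pweight_ge0 x : 0 <= pweight mu x.
Proof. by apply: prodr_ge0. Qed.

Lemma pweight_sum1 : \sum_(x : pt) pweight mu x = 1.
Proof.
rewrite /pweight -(bigA_distr_bigA (fun _ a => mu a)) /=.
by apply: big1 => i _.
Qed.

Lemma ExpnD f g : E (fun x => f x + g x) = E f + E g.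
Proof. by rewrite -big_split; apply: eq_bigr => x _; rewrite mulrDr. Qed.

Lemma ExpnZ c f : E (fun x => c * f x) = c * E f.
Proof. by rewrite /Expn mulr_sumr; apply: eq_bigr => x _; rewrite mulrCA. Qed.

Lemma ExpnB f g : E (fun x => f x - g x) = E f - E g.
Proof.
by rewrite /Expn -sumrB; apply: eq_bigr => x _; rewrite mulrBr.
Qed.

Lemma Expn_cst c : E (fun=> c) = c.
Proof. by rewrite /Expn -mulr_suml pweight_sum1 mul1r. Qed.

Lemma Expn_sum (I : finType) (Q : pred I) (F : I -> fn) :
  E (fun x => \sum_(i | Q i) F i x) = \sum_(i | Q i) E (F i).
Proof.
rewrite /Expn exchange_big; apply: eq_bigr => x _.
by rewrite mulr_sumr.
Qed.

Lemma eq_Expn f g : f =1 g -> E f = E g.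
Proof. by move=> fg; apply: eq_bigr => x _; rewrite fg. Qed.

Lemma le_Expn f g : (forall x, f x <= g x) -> E f <= E g.
Proof.
by move=> fg; apply: ler_sum => x _; rewrite ler_wpM2l ?pweight_ge0.
Qed.

Lemma Expn_ge0 f : (forall x, 0 <= f x) -> 0 <= E f.
Proof. by move=> f0; rewrite -[0](Expn_cst 0) le_Expn. Qed.

Lemma Expn_Eop i f : E (Eop mu i f) = E f.
Proof.
rewrite /Expn /Eop.
under eq_bigr => x _ do rewrite mulr_sumr.
rewrite pair_big /=.
(* Swapping the coordinate [x i] with the fresh sample preserves the joint weight. *)
pose s (p : pt * Omega) := (upd p.1 i p.2, p.1 i).
have sK : involutive s.
  by move=> [x a]; rewrite /s /= upd_upd upd_id ffunE eqxx.
rewrite (reindex_inj (inv_inj sK)) /=.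
rewrite -(pair_bigA _ (fun x a => pweight mu (upd x i a) *
  (mu (x i) * f (upd (upd x i a) i (x i))))) /=.
apply: eq_bigr => x _.
rewrite -[in RHS](mul1r (pweight mu x)) -mu_sum1 mulr_suml mulr_suml.
apply: eq_bigr => a _; rewrite upd_upd upd_id mulrA; congr (_ * _).
rewrite /pweight (bigD1 i) //= [in RHS](bigD1 i) //= ffunE eqxx.
rewrite (eq_bigr (fun j => mu (x j))); last first.
  by move=> j /negbTE ji; rewrite ffunE ji.
by rewrite mulrAC mulrA.
Qed.

Lemma EopC i j f : Eop mu i (Eop mu j f) = Eop mu j (Eop mu i f).
Proof.
have [->//|ij] := eqVneq i j.
apply/funext => x; rewrite /Eop.
under eq_bigr => a _ do rewrite mulr_sumr.
rewrite exchange_big; apply: eq_bigr => b _; rewrite mulr_sumr.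
by apply: eq_bigr => a _; rewrite mulrCA updC.
Qed.

Lemma Eop_invariant i f : (forall x a, f (upd x i a) = f x) -> Eop mu i f = f.
Proof.
move=> fi; apply/funext => x; rewrite /Eop.
under eq_bigr => a _ do rewrite fi.
by rewrite -mulr_suml mu_sum1 mul1r.
Qed.

Lemma Eop_upd i f x a : Eop mu i f (upd x i a) = Eop mu i f x.
Proof. by apply: eq_bigr => b _; rewrite upd_upd. Qed.

Lemma Eop_idem i f : Eop mu i (Eop mu i f) = Eop mu i f.
Proof. by apply: Eop_invariant => x a; apply: Eop_upd. Qed.

Lemma Eop_sum (I : finType) (Q : pred I) i (F : I -> fn) :
  Eop mu i (fun x => \sum_(k | Q k) F k x) =
  (fun x => \sum_(k | Q k) Eop mu i (F k) x).
Proof.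
apply/funext => x; rewrite /Eop exchange_big; apply: eq_bigr => a _.
by rewrite mulr_sumr.
Qed.

Lemma EopB i f g : Eop mu i (fun x => f x - g x) =
  (fun x => Eop mu i f x - Eop mu i g x).
Proof.
apply/funext => x; rewrite /Eop -sumrB.
by apply: eq_bigr => a _; rewrite mulrBr.
Qed.

Lemma Lop_sum (I : finType) (Q : pred I) i (F : I -> fn) :
  Lop mu i (fun x => \sum_(k | Q k) F k x) =
  (fun x => \sum_(k | Q k) Lop mu i (F k) x).
Proof. by apply/funext => x; rewrite /Lop Eop_sum -sumrB. Qed.

Lemma EopLop i f : Eop mu i (Lop mu i f) = fun=> 0.
Proof. by apply/funext => x; rewrite /Lop EopB Eop_idem subrr. Qed.

Lemma LopEop i f : Lop mu i (Eop mu i f) = fun=> 0.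
Proof. by apply/funext => x; rewrite /Lop Eop_idem subrr. Qed.

Lemma Lop_idem i f : Lop mu i (Lop mu i f) = Lop mu i f.
Proof. by apply/funext => x; rewrite {1}/Lop EopLop subr0. Qed.

Lemma Expn_mulEop i f g :
  E (fun x => Eop mu i f x * g x) = E (fun x => f x * Eop mu i g x).
Proof.
rewrite -(Expn_Eop i (fun x => _ * g x)) -(Expn_Eop i (fun x => f x * _)).
apply: eq_Expn => x; rewrite /Eop.
under eq_bigr => a _ do rewrite [\sum_(b : _) _]Eop_upd.
under [RHS]eq_bigr => a _ do rewrite [\sum_(b : _) _]Eop_upd.
rewrite -/(Eop mu i g x) -/(Eop mu i f x).
under eq_bigr => a _ do rewrite mulrCA.
under [RHS]eq_bigr => a _ do rewrite mulrA.
by rewrite -mulr_sumr -mulr_suml mulrC.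
Qed.

Lemma Expn_mulLop i f g :
  E (fun x => Lop mu i f x * g x) = E (fun x => f x * Lop mu i g x).
Proof.
rewrite /Lop; under eq_Expn => x do rewrite mulrBl.
under [RHS]eq_Expn => x do rewrite mulrBr.
by rewrite !ExpnB Expn_mulEop.
Qed.

(** * The components [f^{=T}] as products of commuting one-coordinate factors *)

Definition opQ T i f : fn := if i \in T then Lop mu i f else Eop mu i f.

Lemma opQC T T' i j f : opQ T i (opQ T' j f) = opQ T' j (opQ T i f).
Proof.
have EL k l g : Eop mu k (Lop mu l g) = Lop mu l (Eop mu k g).
  by apply/funext => x; rewrite /Lop EopB EopC.
have LL k l g : Lop mu k (Lop mu l g) = Lop mu l (Lop mu k g).
  by apply/funext => x; rewrite {1 2}/Lop {1 2}/Lop !EopB !(EopC k l); ring.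
rewrite /opQ; case: (i \in T); case: (j \in T').
- exact: LL.
- by rewrite EL.
- exact: EL.
- exact: EopC.
Qed.

Definition opl T (s : seq 'I_n) f : fn := foldr (opQ T) f s.

Lemma opQ_opl T T' i s f : opQ T i (opl T' s f) = opl T' s (opQ T i f).
Proof. by elim: s => //= j s IH; rewrite opQC IH. Qed.

Lemma opl_perm T s s' f : perm_eq s s' -> opl T s f = opl T s' f.
Proof.
move=> ss'; pose Q s2 := opl T s f = opl T s2 f.
apply: (@catCA_perm_ind _ Q _ s s' ss') => // s1 s2 s3; rewrite /Q => ->.
rewrite /opl !foldr_cat -/(opl T s3 f); elim: s1 => //= i s1 ->.
by rewrite -/(opl T s2 _) opQ_opl.
Qed.

Lemma opl_Eop T s f : {in s, forall i, i \notin T} ->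
  opl T s f = foldr (@Eop R Omega mu n) f s.
Proof.
elim: s => //= i s IH sT; rewrite IH; last first.
  by move=> j js; apply: sT; rewrite inE js orbT.
by rewrite /opQ (negbTE (sT i _)) // mem_head.
Qed.

Lemma opl_Lop T s f : {in s, forall i, i \in T} ->
  opl T s f = foldr (@Lop R Omega mu n) f s.
Proof.
elim: s => //= i s IH sT; rewrite IH; last first.
  by move=> j js; apply: sT; rewrite inE js orbT.
by rewrite /opQ sT // mem_head.
Qed.

Lemma eq_opl T T' s f : {in s, forall i, (i \in T) = (i \in T')} ->
  opl T s f = opl T' s f.
Proof.
elim: s => //= i s IH sT; rewrite IH; last first.
  by move=> j js; apply: sT; rewrite inE js orbT.
by rewrite /opQ sT // mem_head.
Qed.

Lemma perm_enum_setC T : perm_eq (enum (~: T) ++ enum T) (enum 'I_n).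
Proof.
apply: uniq_perm; last by move=> i; rewrite mem_cat !mem_enum !inE orNb.
  rewrite cat_uniq !enum_uniq andbT; apply/hasPn => i /=.
  by rewrite !mem_enum inE => ->.
exact: enum_uniq.
Qed.

Lemma fEqT_opl T s f : perm_eq s (enum 'I_n) -> P f T = opl T s f.
Proof.
move=> ps; rewrite (@opl_perm T s (enum (~: T) ++ enum T)); last first.
  by rewrite (perm_trans ps) // perm_sym perm_enum_setC.
rewrite /opl foldr_cat -!/(opl _ _ _) [opl T (enum T) f]opl_Lop.
  by rewrite opl_Eop // => i; rewrite mem_enum inE.
by move=> i; rewrite mem_enum.
Qed.

Lemma foldr_Eop_mix s f x : uniq s ->
  foldr (@Eop R Omega mu n) f s x = E (fun y => f (mix [set i in s] y x)).
Proof.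
elim: s x => [|i s IH] x /=.
  by rewrite -[LHS]Expn_cst => _; apply: eq_Expn => y; rewrite set_nil mix_set0.
case/andP=> si us; rewrite -[RHS](Expn_Eop i) /Eop Expn_sum.
apply: eq_bigr => a _; rewrite ExpnZ IH //; congr (_ * _).
apply: eq_Expn => y; rewrite set_cons mix_setU1 ffunE eqxx; congr f.
apply/ffunP => j; rewrite !ffunE !inE; case: eqP => // ->.
by rewrite (negbTE si).
Qed.

Lemma ES_mix S f x : ES mu S f x = E (fun y => f (mix S y x)).
Proof. by rewrite /ES foldr_Eop_mix ?enum_uniq // set_enum. Qed.

Lemma Expn_mix S f : E (fun x => E (fun y => f (mix S x y))) = E f.
Proof.
have F s g : E (foldr (@Eop R Omega mu n) g s) = E g.
  by elim: s g => //= i s IH g; rewrite Expn_Eop.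
rewrite -[RHS](F (enum (~: S))); apply: eq_Expn => x.
rewrite foldr_Eop_mix ?enum_uniq //; apply: eq_Expn => y; congr f.
by apply/ffunP => j; rewrite !ffunE set_enum inE; case: (j \in S).
Qed.

Lemma fEqT_dep f T x y : {in T, x =1 y} -> P f T x = P f T y.
Proof.
move=> xy; rewrite /fEqT !ES_mix; apply: eq_Expn => z; congr (LS _ _ _ _).
apply/ffunP => j; rewrite !ffunE inE; case: ifPn => //.
by rewrite negbK => /xy.
Qed.

Lemma opl_idem T s f : opl T s (opl T s f) = opl T s f.
Proof.
elim: s f => //= i s IH f.
rewrite -opQ_opl IH /opQ; case: (i \in T); [exact: Lop_idem|exact: Eop_idem].
Qed.

(** At a coordinate where [T] and [T'] differ, a factor [Lop] meets a factor [Eop], and their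
    product is zero. *)
Lemma fEqT_fEqT f T T' :
  P (P f T') T = if T == T' then P f T else fun=> 0.
Proof.
case: eqP => [<-|/eqP TT']; rewrite !(@fEqT_opl _ (enum 'I_n)) ?opl_idem //.
have [i iTT'] : exists i, (i \in T) != (i \in T').
  apply/existsP; apply: contraNT TT' => /existsPn H; apply/eqP/setP => i.
  by have := H i; rewrite negbK => /eqP.
have ie : i \in enum 'I_n by rewrite mem_enum.
rewrite !(@opl_perm _ _ _ _ (perm_to_rem ie)) /= -opQ_opl.
move: (opl T _ _) iTT' => g; rewrite /opQ.
case: (i \in T); case: (i \in T') => // _; [exact: LopEop|exact: EopLop].
Qed.

Lemma Expn_fEqT_adjoint f g T :
  E (fun x => P f T x * g x) = E (fun x => f x * P g T x).
Proof.
rewrite !(@fEqT_opl _ (enum 'I_n)) //; elim: (enum 'I_n) f g => //= i s IH f g.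
rewrite [opQ T i (opl T s g)]opQ_opl -IH /opQ; case: ifP => _.
  exact: Expn_mulLop.
exact: Expn_mulEop.
Qed.

Lemma fEqT_sum (I : finType) (Q : pred I) (F : I -> fn) T :
  P (fun x => \sum_(k | Q k) F k x) T = (fun x => \sum_(k | Q k) P (F k) T x).
Proof.
have H s : opl T s (fun x => \sum_(k | Q k) F k x) =
    (fun x => \sum_(k | Q k) opl T s (F k) x).
  elim: s => //= i s ->; rewrite /opQ; case: ifP => _.
    exact: Lop_sum.
  exact: Eop_sum.
rewrite (@fEqT_opl _ (enum 'I_n)) // H; apply/funext => x.
by apply: eq_bigr => k _; rewrite (@fEqT_opl _ (enum 'I_n)).
Qed.

(** * Derivatives, their components and their globalness *)

Definition deriv A x f : fn := fun y => LS mu A f (mix A x y).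

Lemma opQ_mix T i S x f : i \notin S ->
  opQ T i (fun y => f (mix S x y)) = (fun y => opQ T i f (mix S x y)).
Proof.
move=> iS; have H : Eop mu i (fun y => f (mix S x y)) =
    (fun y => Eop mu i f (mix S x y)).
  by apply/funext => y; apply: eq_bigr => a _; rewrite mix_upd.
rewrite /opQ; case: ifP => // _; apply/funext => y; by rewrite /Lop H.
Qed.

(** Components of [f] at sets containing [A] are components of its derivative along [A]: the factors
    over [A] build the derivative, and those outside [A] commute with freezing the coordinates in
    [A]. *)
Lemma fEqT_deriv f A B x y : [disjoint A & B] ->
  P f (A :|: B) (mix A x y) = P (deriv A x f) B y.
Proof.
move=> AB; rewrite !(fEqT_opl _ _ _ (perm_enum_setC A)) /opl !foldr_cat.
rewrite -!/(opl _ _ _) [opl _ (enum A) f]opl_Lop; last first.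
  by move=> i; rewrite mem_enum inE => ->.
rewrite [opl B (enum A) _]opl_Eop; last first.
  by move=> i; rewrite mem_enum => /(disjointFr AB) ->.
rewrite -/(LS mu A f).
(* The derivative ignores the coordinates in [A], so averaging over them changes nothing. *)
have -> : foldr (@Eop R Omega mu n) (deriv A x f) (enum A) = deriv A x f.
  have : {subset enum A <= A} by move=> i; rewrite mem_enum.
  elim: (enum A) => //= i s IH sA; rewrite IH; last first.
    by move=> j js; apply: sA; rewrite inE js orbT.
  apply: Eop_invariant => z a; rewrite /deriv; congr (LS _ _ _ _).
  apply/ffunP => j; rewrite !ffunE; case: ifPn => // jA; case: eqP => // ji.
  by rewrite ji sA ?mem_head in jA.
rewrite (@eq_opl _ B); last by move=> i; rewrite mem_enum !inE => /negbTE ->.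
have : {in enum (~: A), forall i, i \notin A} by move=> i; rewrite mem_enum inE.
rewrite /deriv; elim: (enum (~: A)) y => //= i s IH y sA.
have <- : (fun y => opl B s (LS mu A f) (mix A x y)) =
    opl B s (fun y => LS mu A f (mix A x y)).
  by apply/funext => z; apply: IH => j js; apply: sA; rewrite inE js orbT.
by rewrite opQ_mix // sA // mem_head.
Qed.

(** A substitute for Minkowski's inequality when all the functions share one moment bound [W], free
    of roots. *)
Lemma Expn_power_mean (I : finType) (Q : pred I) (w : I -> R) (G : I -> fn)
    W k :
  (forall l : I, 0 <= w l) -> (forall (l : I) x, 0 <= G l x) ->
  (forall l : I, Q l -> E (fun x => G l x ^+ k) <= W ^+ k) ->
  E (fun x => (\sum_(l | Q l) w l * G l x) ^+ k) <=
    ((\sum_(l | Q l) w l) * W) ^+ k.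
Proof.
move=> w0 G0 GW; case: k GW => [|k] GW.
  by rewrite expr0; under eq_Expn => x do rewrite expr0; rewrite Expn_cst.
have S0 : 0 <= \sum_(l | Q l) w l by apply: sumr_ge0.
have pm x := power_mean _ _ Q w (G^~ x) k w0 (G0^~ x).
apply: le_trans (le_Expn _ _ pm) _.
rewrite ExpnZ Expn_sum exprMn [in leRHS]exprSr -mulrA ler_wpM2l ?exprn_ge0 //.
rewrite mulr_suml ler_sum // => l Ql; rewrite ExpnZ ler_wpM2l //; exact: GW.
Qed.

Lemma sum_option (I : finType) (F : option I -> R) :
  \sum_o F o = F None + \sum_(l : I) F (Some l).
Proof.
rewrite (bigD1 None) //=; congr (_ + _).
by rewrite (reindex_omap Some id) => [|[]//]; apply: eq_bigl => l; rewrite eqxx.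
Qed.

(** The norm hypotheses of the theorem, with [p] equal to 1 or 2, stated for [p]-th powers to avoid
    roots; [k] is the number of coordinates that may still be fixed. *)
Definition global (r : R) p f k c := forall S x, (#|S| <= k)%N ->
  E (fun y => `|f (mix S x y)| ^+ p) <= (r ^+ #|S| * c) ^+ p.

Lemma global_Lop r p f k c i a : 1 <= r -> 0 <= c ->
  global r p f k.+1 c ->
  global r p (fun y => Lop mu i f (upd y i a)) k (2 * r * c).
Proof.
move=> r1 c0 fc S x Sk.
have r0 : 0 <= r by lra.
have cS : (#|i |: S| <= #|S|.+1)%N.
  by rewrite cardsU1 -add1n leq_add2r leq_b1.
(* [Lop] with coordinate [i] set to [a] is bounded by one restriction of weight 1 ([None]) plus the
   [mu]-average of others: total weight 2. Fixing [i] costs one factor [r], hence the constant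
   [2 r]. *)
pose w (o : option Omega) := if o is Some b then mu b else 1.
pose v (o : option Omega) := if o is Some b then b else a.
pose G o y := `|f (mix (i |: S) (upd x i (v o)) y)|.
have fG b y : f (upd (mix S x y) i b) = f (mix (i |: S) (upd x i b) y).
  congr f; rewrite mix_setU1 ffunE eqxx.
  apply/ffunP => j; rewrite !ffunE; case: eqP => //.
have w0 o : 0 <= w o by case: o => /=.
have w2 : \sum_o w o = 2.
  by rewrite sum_option /= mu_sum1.
have H : E (fun y => (\sum_o w o * G o y) ^+ p) <=
    ((\sum_o w o) * (r ^+ #|S|.+1 * c)) ^+ p.
  apply: (Expn_power_mean _ predT w G) => // [o x'|o _]; first exact: normr_ge0.
  apply: le_trans (fc _ _ _) _; first exact: leq_trans cS _.
  rewrite lerXn2r ?nnegrE ?mulr_ge0 ?exprn_ge0 // ler_wpM2r //.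
  by rewrite ler_weXn2l.
apply: (@le_trans _ _ (E (fun y => (\sum_o w o * G o y) ^+ p))).
  apply: le_Expn => y; rewrite lerXn2r ?nnegrE ?normr_ge0 //.
    by apply: sumr_ge0 => o _; rewrite mulr_ge0 ?normr_ge0.
  rewrite /Lop (le_trans (ler_normB _ _)) // sum_option /= mul1r.
  rewrite lerD //; first by rewrite fG.
  rewrite Eop_upd (le_trans (ler_norm_sum _ _ _)) // ler_sum // => b _.
  by rewrite normrM (ger0_norm (mu_ge0 b)) fG.
by rewrite (le_trans H) // w2 exprS; apply: le_of_eq; congr (_ ^+ _); ring.
Qed.

Lemma global_deriv r p f k c A x : 1 <= r -> 0 <= c ->
  global r p f (#|A| + k) c -> global r p (deriv A x f) k ((2 * r) ^+ #|A| * c).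
Proof.
move=> r1 c0 fc.
rewrite /deriv /LS -{2}(set_enum A) cardE; rewrite cardE in fc.
elim: (enum A) (enum_uniq A) k fc => [|i s IH] us k fc /=.
  rewrite expr0 mul1r => S y Sk; under eq_Expn => z do
    rewrite set_nil mix_set0; exact: fc.
case/andP: us => si us.
have := IH us k.+1; rewrite addnS => /(_ fc).
move/(@global_Lop r p _ k _ i (x i) r1).
rewrite mulr_ge0 ?exprn_ge0 //; last by lra.
move/(_ isT); rewrite mulrA -exprS.
set u1 := (X in global _ _ X); set u2 := (X in _ -> global _ _ X _ _).
suff -> : u1 = u2 by [].
apply/funext => y; have iS : i \notin [set j in s] by rewrite inE.
rewrite /u1 /u2 set_cons mix_setU1 /Lop /Eop mix_upd //=.
congr (_ - _); apply: eq_bigr => a _.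
by rewrite !mix_upd.
Qed.

(** * Square-function hypercontractivity *)

Lemma moment_step (I : finType) (Q : pred I) (w : I -> R) (F : I -> fn) i m :
  (0 < m)%N -> (forall k, 0 <= w k) ->
  E (fun x => (\sum_(k | Q k) w k * F k x ^+ 2) ^+ m) <=
  E (fun x => (\sum_(k | Q k) w k *
     (Eop mu i (F k) x ^+ 2 + 4 * m%:R * Lop mu i (F k) x ^+ 2)) ^+ m).
Proof.
move=> m0 w0.
pose a x := \sum_(k | Q k) w k * Eop mu i (F k) x ^+ 2.
pose b x := \sum_(k | Q k) w k * Lop mu i (F k) x ^+ 2.
pose s x := \sum_(k | Q k) w k * Eop mu i (F k) x * Lop mu i (F k) x.
have pw x : (\sum_(k | Q k) w k * F k x ^+ 2) ^+ m <=
   (\sum_(k | Q k) w k *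
     (Eop mu i (F k) x ^+ 2 + 4 * m%:R * Lop mu i (F k) x ^+ 2)) ^+ m +
   2 * m%:R * (a x ^+ m.-1 * s x).
  have -> : \sum_(k | Q k) w k * F k x ^+ 2 = a x + 2 * s x + b x.
    rewrite mulr_sumr -!big_split /=; apply: eq_bigr => k _.
    by rewrite /Lop; ring.
  have -> : \sum_(k | Q k) w k *
     (Eop mu i (F k) x ^+ 2 + 4 * m%:R * Lop mu i (F k) x ^+ 2) =
     a x + 4 * m%:R * b x.
    rewrite mulr_sumr -!big_split /=; apply: eq_bigr => k _; ring.
  apply: two_point_vector => //; last exact: cauchy_schwarz_sum.
  - by apply: sumr_ge0 => k _; rewrite mulr_ge0 ?sqr_ge0.
  - by apply: sumr_ge0 => k _; rewrite mulr_ge0 ?sqr_ge0.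
apply: le_trans (le_Expn _ _ pw) _; rewrite ExpnD ExpnZ.
(* Self-adjointness moves [Lop] onto the cofactor, which does not depend on coordinate [i]. *)
suff -> : E (fun x => a x ^+ m.-1 * s x) = 0 by rewrite mulr0 addr0.
under eq_Expn => x do rewrite mulr_sumr.
rewrite Expn_sum big1 // => k _.
have ai x c : a (upd x i c) = a x.
  by apply: eq_bigr => l _; rewrite Eop_upd.
under eq_Expn => x do rewrite mulrA.
rewrite -Expn_mulLop -[RHS](Expn_cst 0); apply: eq_Expn => x.
rewrite /Lop [Eop mu i (fun _ => _ * _)]Eop_invariant ?subrr ?mul0r // => y c.
by rewrite ai Eop_upd.
Qed.

Lemma sum_subset_setU1 (i : 'I_n) S (phi : {set 'I_n} -> R) : i \notin S ->
  \sum_(T : {set 'I_n} | T \subset i |: S) phi T =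
  \sum_(T : {set 'I_n} | T \subset S) (phi T + phi (i |: T)).
Proof.
move=> iS; rewrite (bigID (fun T => i \in T)) /= addrC big_split /=.
congr (_ + _).
  apply: eq_bigl => T; apply/andP/idP => [[TS iT]|TS].
    by rewrite -(setU1K iS) subsetD1 TS iT.
  split; first exact: subset_trans TS (subsetUr _ _).
  by apply: contraNN iS; apply: (subsetP TS).
rewrite (reindex_onto (fun T => i |: T) (fun T => T :\ i)) /=; last first.
  by move=> T /andP[_ iT]; rewrite setD1K.
apply: eq_bigl => T; rewrite setU11 andbT.
apply/andP/idP => [[TS /eqP <-]|TS].
  by rewrite subDset.
have iT : i \notin T by apply: contraNN iS; apply: (subsetP TS).
by rewrite setUS // setU1K.
Qed.

(** Each processed coordinate splits every term into an [Eop] part and a [Lop] part of weight [4 m];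
    the [T] reached collects the coordinates where [Lop] was taken. *)
Lemma moment_le_square_function f m : (0 < m)%N ->
  E (fun x => f x ^+ (2 * m)) <=
  E (fun x => (\sum_(T : {set 'I_n}) (4 * m%:R) ^+ #|T| * P f T x ^+ 2) ^+ m).
Proof.
move=> m0; set c := 4 * m%:R.
have c0 : 0 <= c by rewrite /c mulr_ge0.
have H s : uniq s -> E (fun x => f x ^+ (2 * m)) <=
  E (fun x => (\sum_(T : {set 'I_n} | T \subset [set i in s])
     c ^+ #|T| * opl T s f x ^+ 2) ^+ m).
  elim: s => [_|i s IH] /=.
    apply: le_Expn => x; rewrite set_nil.
    under eq_bigl => T do rewrite subset0.
    by rewrite big_pred1_eq cards0 expr0 mul1r exprM.
  case/andP=> si /IH H; apply: (le_trans H); apply: le_trans.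
    by apply: (@moment_step _ _ _ _ i) => // T; rewrite exprn_ge0.
  apply/le_of_eq/eq_Expn => x; congr (_ ^+ _).
  rewrite set_cons sum_subset_setU1 ?inE //; apply: eq_bigr => T TS.
  have iT : i \notin T.
    by apply: contraNN si => /(subsetP TS); rewrite inE.
  rewrite [opl (i |: T) s f](@eq_opl _ T); last first.
    move=> j js; rewrite !inE; case: eqP => // ji.
    by rewrite ji (negbTE si) in js.
  by rewrite /= /opQ setU11 (negbTE iT) cardsU1 iT add1n (exprSr c) -/c
    mulrDr mulrA.
apply: le_trans (H _ (enum_uniq 'I_n)) _; apply/le_of_eq/eq_Expn => x.
congr (_ ^+ _); apply: eq_big => [T|T _].
  by apply/subsetP => i _; rewrite inE mem_enum.
by rewrite (@fEqT_opl _ (enum 'I_n)).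
Qed.

Lemma fEqT_fEqd f d T :
  P (fEqd mu f d) T = if #|T| == d then P f T else fun=> 0.
Proof.
rewrite /fEqd fEqT_sum; apply/funext => x.
under eq_bigr => T' _ do rewrite fEqT_fEqT.
case: ifPn => Td.
  rewrite (bigD1 T) //= eqxx big1 ?addr0 // => T' /andP[_ /negbTE].
  by rewrite eq_sym => ->.
rewrite big1 // => T' T'd; case: eqP => // TT'.
by rewrite TT' T'd in Td.
Qed.

Definition level_sq f d x := \sum_(T : {set 'I_n} | #|T| == d) P f T x ^+ 2.

Lemma level_sq_ge0 f d x : 0 <= level_sq f d x.
Proof. by apply: sumr_ge0 => T _; apply: sqr_ge0. Qed.

Lemma moment_fEqd f d m : (0 < m)%N ->
  E (fun x => fEqd mu f d x ^+ (2 * m)) <=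
  (4 * m%:R) ^+ (d * m) * E (fun x => level_sq f d x ^+ m).
Proof.
move=> m0; apply: le_trans (moment_le_square_function _ _ m0) _.
rewrite -ExpnZ; apply/le_of_eq/eq_Expn => x.
rewrite exprM -exprMn; congr (_ ^+ _).
rewrite /level_sq mulr_sumr (bigID (fun T : {set 'I_n} => #|T| == d)) /=.
rewrite [X in _ + X]big1 ?addr0 => [|T /negbTE Td].
  by apply: eq_bigr => T Td; rewrite fEqT_fEqd Td (eqP Td).
by rewrite fEqT_fEqd Td expr0n mulr0.
Qed.

(** * Parseval and interpolation between the norms *)

Lemma Expn_mul_fEqd f d :
  E (fun x => f x * fEqd mu f d x) = E (level_sq f d).
Proof.
under eq_Expn => x do rewrite mulr_sumr.
rewrite /level_sq !Expn_sum; apply: eq_bigr => T _.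
under [RHS]eq_Expn => x do rewrite expr2.
by rewrite Expn_fEqT_adjoint fEqT_fEqT eqxx.
Qed.

Lemma Expn_fEqd_sq f d : E (fun x => fEqd mu f d x ^+ 2) = E (level_sq f d).
Proof.
rewrite -Expn_mul_fEqd; under eq_Expn => x do rewrite expr2.
under eq_Expn => x do rewrite {1}/fEqd mulr_suml.
under [RHS]eq_Expn => x do rewrite {1}/fEqd mulr_sumr.
rewrite !Expn_sum; apply: eq_bigr => T Td.
by rewrite Expn_fEqT_adjoint fEqT_fEqd Td.
Qed.

(** Hoelder in two moves: a power mean with weight [|f|] raises [|g|] to the power [k + 1], then
    Cauchy-Schwarz separates [f] from [g]. *)
Lemma duality f g k :
  E (fun x => f x * g x) ^+ (2 * k.+1) <=
  E (fun x => `|f x|) ^+ (2 * k) * E (fun x => f x ^+ 2) *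
  E (fun x => g x ^+ (2 * k.+1)).
Proof.
set M := E (fun x => `|f x|).
have M0 : 0 <= M by apply: Expn_ge0.
have fg0 : 0 <= E (fun x => `|f x| * `|g x|).
  by apply: Expn_ge0 => x; rewrite mulr_ge0.
have H0 : `|E (fun x => f x * g x)| <= E (fun x => `|f x| * `|g x|).
  rewrite (le_trans (ler_norm_sum _ _ _)) // ler_sum // => x _.
  by rewrite !normrM ger0_norm ?pweight_ge0.
have H1 : E (fun x => `|f x| * `|g x|) ^+ k.+1 <=
    M ^+ k * E (fun x => `|f x| * `|g x| ^+ k.+1).
  have := power_mean _ _ predT (fun x => pweight mu x * `|f x|)
    (fun x => `|g x|) k.
  rewrite /M /Expn /=.
  under eq_bigr => x _ do rewrite -mulrA.
  under [X in _ -> _ -> _ <= _ * X]eq_bigr => x _ do rewrite -mulrA.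
  by apply => // x; rewrite mulr_ge0 ?pweight_ge0.
have H2 : E (fun x => `|f x| * `|g x| ^+ k.+1) ^+ 2 <=
    E (fun x => f x ^+ 2) * E (fun x => g x ^+ (2 * k.+1)).
  have := cauchy_schwarz_sum _ _ predT (fun x => pweight mu x)
    (fun x => `|f x|) (fun x => `|g x| ^+ k.+1) (pweight_ge0).
  rewrite /Expn /=.
  under eq_bigr => x _ do rewrite -mulrA.
  under [X in _ <= X * _ -> _]eq_bigr => x _ do rewrite real_normK ?num_real //.
  under [X in _ <= _ * X -> _]eq_bigr => x _ do
    rewrite -exprM mulnC exprM real_normK ?num_real // -exprM.
  by [].
rewrite mulnC exprM.
apply: (@le_trans _ _ ((M ^+ k * E (fun x => `|f x| * `|g x| ^+ k.+1)) ^+ 2)).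
  rewrite -[leLHS]real_normK ?num_real // lerXn2r ?nnegrE ?normr_ge0 //.
    rewrite mulr_ge0 ?exprn_ge0 // Expn_ge0 // => x.
    by rewrite mulr_ge0 ?exprn_ge0.
  by rewrite normrX (le_trans _ H1) // lerXn2r ?nnegrE ?normr_ge0.
by rewrite exprMn -exprM mulnC -mulrA ler_wpM2l ?exprn_ge0 // (mulnC k.+1).
Qed.

(** * Conditioning and the moment induction *)

Lemma level_sq_mix f d T x y : #|T| = d ->
  level_sq f d (mix T x y) <=
  \sum_(A : {set 'I_n} | A \subset T) level_sq (deriv A x f) (d - #|A|)%N y.
Proof.
move=> Td; rewrite /level_sq.
(* Each [S] of size [d] is sorted by its trace [A] on [T] and written as the union of [A] and [B],
   with [B] outside [T]. Sets [B] meeting [T] occur only on the right, with nonnegative terms. *)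
rewrite (partition_big (fun S => S :&: T) (fun A => A \subset T)) /=;
  last first.
  by move=> S _; apply: subsetIr.
apply: ler_sum => A AT.
rewrite (reindex_onto (fun B => A :|: B) (fun S => S :\: T)) /=; last first.
  by move=> S /andP[_ /eqP <-]; rewrite setID.
rewrite [leLHS]big_mkcond [leRHS]big_mkcond /=; apply: ler_sum => B _.
case: ifP => [/andP[/andP[/eqP cAB /eqP AB] /eqP BT]|_]; last first.
  by case: ifP => // _; apply: sqr_ge0.
have dTB : [disjoint T & B] by rewrite -BT disjoints_subset setCD subsetUr.
have dAB : [disjoint A & B] by apply: disjointWl dTB.
have -> : #|B| == (d - #|A|)%N.
  by rewrite -cAB cardsU disjoint_setI0 // cards0 subn0 addKn.
rewrite -fEqT_deriv // (@fEqT_dep _ _ (mix T x y) (mix A x y)) // => j.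
rewrite inE => /orP[jA|jB]; rewrite !ffunE.
  by rewrite jA (subsetP AT).
by rewrite (disjointFl dTB jB) (disjointFl dAB jB).
Qed.

Lemma sum_subset_pow (c : R) T :
  \sum_(A : {set 'I_n} | A \subset T) c ^+ #|A| = (1 + c) ^+ #|T|.
Proof.
rewrite -{1}(set_enum T) cardE; elim: (enum T) (enum_uniq T) => [_|i s IH] /=.
  under eq_bigl => A do rewrite set_nil subset0.
  by rewrite big_pred1_eq cards0.
case/andP=> si /IH {}IH; rewrite set_cons sum_subset_setU1 ?inE // exprS -IH.
rewrite mulr_sumr; apply: eq_bigr => A AS.
have iA : i \notin A by apply: contraNN si => /(subsetP AS); rewrite inE.
by rewrite cardsU1 iA add1n exprS mulrDl mul1r.
Qed.

Lemma deriv_set0 x f : deriv set0 x f = f.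
Proof. by apply/funext => y; rewrite /deriv /LS enum_set0 mix_set0. Qed.

(* Conditioning on [x_T] turns [E H^(k+1)] into an average of [E H^k] over
   restrictions, each of which splits into the level functions of derivatives. *)
Lemma level_sq_moment_rec f d k (w c : R) :
  0 <= w -> 0 < c ->
  (forall A x, (#|A| <= d)%N ->
    E (fun y => level_sq (deriv A x f) (d - #|A|)%N y ^+ k) <=
      (c ^+ #|A| * w) ^+ k) ->
  E (fun x => level_sq f d x ^+ k.+1) <=
    E (level_sq f d) * ((1 + c) ^+ d * w) ^+ k.
Proof.
move=> w0 c0 H.
have EH T x : #|T| = d ->
    E (fun y => level_sq f d (mix T x y) ^+ k) <= ((1 + c) ^+ d * w) ^+ k.
  (* After division by [c ^+ #|A|] all parts share the bound [w], and the weights [c ^+ #|A|] sum to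
     [(1 + c) ^+ d]. *)
  move=> Td; pose G A y := level_sq (deriv A x f) (d - #|A|)%N y / c ^+ #|A|.
  have G0 A y : 0 <= G A y.
    by rewrite divr_ge0 ?level_sq_ge0 // exprn_ge0 // ltW.
  rewrite -Td -sum_subset_pow.
  apply: le_trans (Expn_power_mean _ (fun A => A \subset T)
    (fun A => c ^+ #|A|) G w k _ G0 _); last 2 first.
  - by move=> A; rewrite exprn_ge0 // ltW.
  - move=> A AT; rewrite /G.
    under eq_Expn => y do rewrite exprMn mulrC.
    rewrite ExpnZ exprVn ler_pdivrMl ?exprn_gt0 // -exprMn.
    by apply: H; rewrite -Td subset_leq_card.
  apply: le_Expn => y; rewrite lerXn2r ?nnegrE ?level_sq_ge0 //.
    by apply: sumr_ge0 => A _; rewrite mulr_ge0 // exprn_ge0 // ltW.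
  apply: le_trans (level_sq_mix f _ T x y erefl) _; apply: ler_sum => A _.
  by rewrite /G -Td mulrC divfK // expf_neq0 // gt_eqF.
rewrite {2}/level_sq Expn_sum mulr_suml.
under eq_Expn => x do rewrite exprS {1}/level_sq mulr_suml.
rewrite Expn_sum; apply: ler_sum => T /eqP Td.
rewrite -(Expn_mix T) [leRHS]mulrC -ExpnZ; apply: le_Expn => x.
have PT y : P f T (mix T x y) = P f T x.
  by apply: fEqT_dep => i iT; rewrite ffunE iT.
under eq_Expn => y do rewrite PT.
by rewrite ExpnZ mulrC ler_wpM2r ?sqr_ge0 ?EH.
Qed.

(** Duality is applied with [g = f^{=d}], where [E f g = E g^2]. The hypothesis on [t] makes the
    bound an exact [m]-th power, so the root can be taken. *)
Lemma level_sq_duality f d m (c t L w : R) : (0 < m)%N ->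
  0 <= c -> 0 <= L -> t ^+ 2 <= L ^+ m -> 0 <= w ->
  E (fun x => `|f x|) <= c -> E (fun x => f x ^+ 2) <= (t * c) ^+ 2 ->
  E (fun x => level_sq f d x ^+ m) <= w ^+ m ->
  E (level_sq f d) ^+ 2 <= c ^+ 2 * L * (4 * m%:R) ^+ d * w.
Proof.
move=> m0 c0 L0 tL w0 f1 f2 Hm.
have F1 : 0 <= E (fun x => `|f x|) by apply: Expn_ge0.
have F2 : 0 <= E (fun x => f x ^+ 2) by apply: Expn_ge0 => x; apply: sqr_ge0.
have m4 : 0 <= 4 * m%:R :> R by rewrite mulr_ge0.
have N0 : 0 <= E (level_sq f d) by apply: Expn_ge0; apply: level_sq_ge0.
rewrite -(ler_pXn2r m0) ?nnegrE ?sqr_ge0 //; last first.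
  by rewrite !mulr_ge0 ?exprn_ge0.
rewrite -exprM -Expn_mul_fEqd.
have := duality f (fEqd mu f d) m.-1; rewrite (prednK m0).
move/le_trans; apply.
have Hg := le_trans (moment_fEqd f d m m0) (ler_wpM2l (exprn_ge0 _ m4) Hm).
apply: (@le_trans _ _ (c ^+ (2 * m.-1) * (L ^+ m * c ^+ 2) *
    ((4 * m%:R) ^+ (d * m) * w ^+ m))).
  apply: ler_pM => //.
  - by rewrite mulr_ge0 ?exprn_ge0.
  - by apply: Expn_ge0 => x; rewrite exprM exprn_ge0 // sqr_ge0.
  apply: ler_pM => //; first by rewrite exprn_ge0.
    by rewrite lerXn2r ?nnegrE.
  apply: le_trans f2 _; by rewrite exprMn ler_wpM2r ?sqr_ge0.
apply: le_of_eq; rewrite !exprMn -!exprM.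
have -> : c ^+ m = c ^+ m.-1 * c by rewrite -exprSr prednK.
rewrite mulnC exprM; ring.
Qed.

Lemma global_norm_le r p f k (c : R) : 0 <= c -> global r p f k c ->
  E (fun x => `|f x| ^+ p) <= c ^+ p.
Proof.
move=> c0 fc; have [x _|xP] := pickP (fun x : pt => true); last first.
  by rewrite /Expn big_pred0 // exprn_ge0.
have := fc set0 x; rewrite cards0 expr0 mul1r => /(_ isT).
by under eq_Expn => y do rewrite mix_set0.
Qed.

Lemma level_sq_zero f x : level_sq f 0 x = E f ^+ 2.
Proof.
rewrite /level_sq; under eq_bigl => T do rewrite cards_eq0.
rewrite big_pred1_eq /fEqT setC0 /LS enum_set0 ES_mix; congr (_ ^+ 2).
apply: eq_Expn => y; congr f.
by apply/ffunP => i; rewrite ffunE in_setT.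
Qed.

Lemma level_sq_moment (r L t : R) m : (0 < m)%N -> 1 <= r -> 0 <= L ->
  t ^+ 2 <= L ^+ m -> 0 <= t ->
  forall d f (c : R), 0 <= c -> global r 1 f d c -> global r 2 f d (t * c) ->
  forall k, (k <= m)%N ->
  E (fun x => level_sq f d x ^+ k) <=
    (c ^+ 2 * L * (16 * m%:R * r ^+ 2) ^+ d) ^+ k.
Proof.
move=> m0 r1 L0 tL t0; elim/ltn_ind => d IH f c c0 g1 g2.
have mR : 1 <= m%:R :> R by rewrite ler1n.
have r0 : 0 <= r by lra.
have r21 : 1 <= r ^+ 2 by rewrite exprn_ege1.
set X := 16 * m%:R * r ^+ 2.
have X0 : 0 <= X by rewrite !mulr_ge0.
(* A derivative along [A] multiplies [c ^+ 2] by [(2 r)^(2|A|)] but lowers the level by [|A|]; with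
   this [rho] the net change is exactly [rho ^+ #|A|]. It is also small enough that
   [(1 + rho) ^+ k <= 2] for [k <= m]. *)
pose rho : R := (4 * m%:R)^-1.
have rho0 : 0 < rho by rewrite invr_gt0; lra.
have Xrho : rho * X = (2 * r) ^+ 2.
  by rewrite /rho /X; field; rewrite lt0r_neq0 //; lra.
pose N := E (level_sq f d).
have N0 : 0 <= N by apply: Expn_ge0; apply: level_sq_ge0.
pose wd := c ^+ 2 * L * X ^+ d.
have wd0 : 0 <= wd by rewrite !mulr_ge0 ?exprn_ge0.
have moments w : wd <= w -> 2 ^+ d * N <= w ->
    forall k, (k <= m)%N -> E (fun x => level_sq f d x ^+ k) <= w ^+ k.
  move=> wdw Nw; have w0 := le_trans wd0 wdw; elim=> [|k IHk] km.
    by rewrite expr0; under eq_Expn => x do rewrite expr0; rewrite Expn_cst.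
  apply: le_trans (level_sq_moment_rec _ _ _ w rho w0 rho0 _) _.
    move=> A x Ad; case: (posnP #|A|) => [A0|A0].
      rewrite (cards0_eq A0) deriv_set0 cards0 subn0 expr0 mul1r.
      exact/IHk/ltnW.
    have dA : (d - #|A| < d)%N by rewrite ltn_subrL A0 (leq_trans A0).
    apply: le_trans (IH _ dA _ ((2 * r) ^+ #|A| * c) _ _ _ _ (ltnW km)) _.
    - by rewrite mulr_ge0 ?exprn_ge0 // mulr_ge0.
    - by apply: global_deriv => //; rewrite subnKC.
    - rewrite mulrCA; apply: global_deriv => //; first by rewrite mulr_ge0.
      by rewrite subnKC.
    rewrite lerXn2r ?nnegrE ?mulr_ge0 ?exprn_ge0 ?mulr_ge0 ?exprn_ge0 //.
      exact: ltW.
    apply: (@le_trans _ _ (rho ^+ #|A| * wd)); last first.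
      by rewrite ler_wpM2l // exprn_ge0 // ltW.
    apply: le_of_eq; rewrite /wd -/X -(subnKC Ad) exprD (subnKC Ad).
    rewrite exprMn -exprM (mulnC _ 2) exprM -Xrho exprMn; ring.
  rewrite exprMn mulrA exprS -/N ler_wpM2r ?exprn_ge0 //.
  apply: le_trans Nw; rewrite mulrC ler_wpM2r //.
  rewrite -exprM mulnC exprM lerXn2r ?nnegrE ?exprn_ge0 //.
  - by rewrite addr_ge0 // ltW.
  - exact: expr1D_inv4_le2 _ _ _ m0 (ltnW km).
suff Nwd : 2 ^+ d * N <= wd by apply: moments.
(* Otherwise [w = 2 ^+ d * N] is admissible in [moments]; duality then gives [N <= 2 ^+ d * Y], so
   [2 ^+ d * N <= 4 ^+ d * Y <= wd], as [4 * 4 m = 16 m]. *)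
rewrite leNgt; apply/negP => wdN.
have M0 := le_lt_trans wd0 wdN.
have f1 : E (fun x => `|f x|) <= c.
  have := global_norm_le r 1 f d c c0 g1; rewrite expr1.
  by under eq_Expn => x do rewrite expr1.
have f2 : E (fun x => f x ^+ 2) <= (t * c) ^+ 2.
  have := global_norm_le r 2 f d _ (mulr_ge0 t0 c0) g2.
  by under eq_Expn => x do rewrite real_normK ?num_real //.
have := level_sq_duality f d m c t L _ m0 c0 L0 tL (ltW M0) f1 f2
  (moments _ (ltW wdN) (lexx _) m (leqnn m)).
rewrite -/N; set Y := c ^+ 2 * L * _ => NY.
have : (2 ^+ d * N) ^+ 2 <= 4 ^+ d * Y * (2 ^+ d * N).
  rewrite exprMn -exprM mulnC exprM (_ : 2 ^+ 2 = 4); last by ring.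
  by rewrite -mulrA ler_wpM2l ?exprn_ge0.
rewrite expr2 ler_pM2r // leNgt => /negP; apply.
apply: le_lt_trans wdN; rewrite /Y /wd mulrCA -mulrA -!mulrA.
rewrite !ler_wpM2l ?sqr_ge0 // -exprMn lerXn2r ?nnegrE ?mulr_ge0 //.
have : m%:R * 1 <= m%:R * r ^+ 2 by rewrite ler_wpM2l.
rewrite /X; lra.
Qed.

End ProductSpace.

Arguments global {R Omega} mu {n}.
Arguments level_sq {R Omega} mu {n}.

(** * Choice of the exponent [m] and the numerical constant *)

Theorem mainTheorem4 (R : realType) (Omega : finType) (mu : Omega -> R)
  (n : nat) (f : pt Omega n -> R) (gamma1 gamma2 r : R) (d : nat) :
  (forall a, 0 <= mu a) -> \sum_(a : Omega) mu a = 1 ->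
  0 < gamma1 -> gamma1 < gamma2 -> 1 < r ->
  (d%:R <= ln (gamma2 / gamma1) / 2) ->
  (forall (S : {set 'I_n}) (x : pt Omega n), (#|S| <= d)%N ->
     L1norm mu (restr f S x) <= r ^+ #|S| * gamma1 /\
     L2norm mu (restr f S x) <= r ^+ #|S| * gamma2) ->
  L2norm mu (fEqd mu f d) ^+ 2 <=
    gamma1 ^+ 2 * (2200 * r ^+ 2 * ln (gamma2 / gamma1) / d%:R) ^+ d.
Proof.
move=> mu0 mu1 g1 g12 r1 dL H.
have g1' : 0 <= gamma1 := ltW g1.
have g2' : 0 <= gamma2 by lra.
have r1' : 1 <= r := ltW r1.
have r0 : 0 <= r by lra.
have G1 : global mu r 1 f d gamma1.
  move=> S x Sd; have [h _] := H S x Sd; rewrite expr1; apply: le_trans h.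
  by apply: le_of_eq; apply: eq_Expn.
pose t := gamma2 / gamma1.
have t0 : 0 < t by rewrite divr_gt0 //; lra.
have G2 : global mu r 2 f d (t * gamma1).
  move=> S x Sd; have [_ h] := H S x Sd.
  rewrite /t divfK ?gt_eqF //.
  have F0 : 0 <= Expn mu (fun y => restr f S x y ^+ 2).
    by apply: Expn_ge0 => // y; apply: sqr_ge0.
  rewrite -[leLHS](_ : L2norm mu (restr f S x) ^+ 2 = _).
    by rewrite lerXn2r ?nnegrE ?sqrtr_ge0 ?mulr_ge0 ?exprn_ge0.
  rewrite sqr_sqrtr //; apply: eq_Expn => y.
  by rewrite real_normK ?num_real.
have -> : L2norm mu (fEqd mu f d) ^+ 2 = Expn mu (level_sq mu f d).
  rewrite sqr_sqrtr ?Expn_fEqd_sq //.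
  by apply: Expn_ge0 => // x; apply: level_sq_ge0.
rewrite -/t in dL *; set l := ln t in dL *.
have el : expR l = t by rewrite lnK.
(* At level 0 the claim is [(E f)^2 <= gamma1^2], which follows from the 1-norm bound. *)
have [d0|dpos] := posnP d.
  rewrite d0 expr0 mulr1.
  under eq_Expn => x do rewrite (level_sq_zero _ _ _ _ mu1).
  rewrite Expn_cst // -[leLHS]real_normK ?num_real //.
  rewrite lerXn2r ?nnegrE ?normr_ge0 //.
  have := global_norm_le _ _ _ _ r 1 f d gamma1 g1' G1; rewrite expr1.
  apply: le_trans; rewrite (le_trans (ler_norm_sum _ _ _)) // ler_sum // => x _.
  by rewrite normrM expr1 ger0_norm ?pweight_ge0.
have dR : 1 <= d%:R :> R by rewrite ler1n.
pose q := l / d%:R.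
have q2 : 2 <= q by rewrite ler_pdivlMr; lra.
pose m := Num.truncn q.
have /andP[mq qm] : m%:R <= q < m.+1%:R by apply: truncn_itv; lra.
have m0 : (0 < m)%N.
  by rewrite -(ltr_nat R); rewrite -natr1 in qm; lra.
have mR : 1 <= m%:R :> R by rewrite ler1n.
rewrite -natr1 in qm.
have m2 : (2 <= m)%N.
  by rewrite -ltnS -(ltr_nat R) -natr1; lra.
have m2R : 2 <= m%:R :> R by rewrite ler_nat.
have ld : l = q * d%:R by rewrite divfK // gt_eqF; lra.
(* Chosen so that [L ^+ m] equals [t ^+ 2]. *)
pose L := expR (2 * l / m%:R).
have Lm : t ^+ 2 <= L ^+ m.
  have mn0 : m%:R != 0 :> R by rewrite gt_eqF //; lra.
  rewrite /L -expRM_natr divfK //.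
  by rewrite -el -expRM_natr mulrC.
have := @level_sq_moment R Omega mu n mu0 mu1 r L t m m0 r1' (expR_ge0 _) Lm
  (ltW t0) d f gamma1 g1' G1 G2 1 m0.
rewrite !expr1; under eq_Expn => x do rewrite expr1.
move/le_trans; apply.
rewrite -mulrA ler_wpM2l ?sqr_ge0 //.
(* Since [m >= 2], [q < m + 1 <= 3 m / 2], so [2 l / m <= 3 d]. *)
have Ld : L <= (expR 1 ^+ 3) ^+ d.
  rewrite -exprM -expRM_natr mul1r ler_expR ler_pdivrMr; last lra.
  rewrite natrM ld.
  have : 2 * q * d%:R <= 3 * m%:R * d%:R by rewrite ler_wpM2r; lra.
  lra.
(* The crude bound [e <= 4], from [e^(-1/2) >= 1/2], suffices: [64 * 16 = 1024 <= 2200]. *)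
have e3 : expR 1 ^+ 3 <= 64 :> R.
  have h1 : 1 / 2 <= expR (- (1 / 2)) :> R.
    by apply: le_trans (expR_ge1Dx _); lra.
  have h2 : expR (1 / 2) * expR (- (1 / 2)) = 1 :> R.
    by rewrite -expRD addrN expR0.
  have h3 : 0 <= expR (1 / 2) :> R := expR_ge0 _.
  have h4 : expR (1 / 2) <= 2 :> R by nra.
  have -> : expR 1 = expR (1 / 2) ^+ 2 :> R.
    by rewrite -expRM_natr; congr expR; lra.
  rewrite -exprM (_ : 64 = 2 ^+ (2 * 3) :> R); last by ring.
  by rewrite lerXn2r ?nnegrE.
apply: (@le_trans _ _ ((64 * (16 * m%:R * r ^+ 2)) ^+ d)).
  rewrite [leRHS]exprMn ler_wpM2r ?exprn_ge0 ?mulr_ge0 ?exprn_ge0 //.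
  by rewrite (le_trans Ld) // lerXn2r ?nnegrE ?exprn_ge0 ?expR_ge0.
have r20 : 0 <= r ^+ 2 := sqr_ge0 r.
have -> : 2200 * r ^+ 2 * l / d%:R = 2200 * (r ^+ 2 * q) by rewrite /q; ring.
have : r ^+ 2 * m%:R <= r ^+ 2 * q by rewrite ler_wpM2l.
have : 0 <= r ^+ 2 * m%:R by rewrite mulr_ge0.
by move=> *; rewrite lerXn2r ?nnegrE //; lra.
Qed.
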